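(* Let $m=1$ and $d\ge3$. If $0\le n\le d-2$, then $C^{(1,d)}_{j,\ell(n+1,k)}=0$ in each of the following cases: - $j<n+1$ and $1\le k\le n+2$; - $j>nd$ and $1\le k\le n$; - $j>nd+1$ and $k=n+1$; - $j>(n+1)d$ and $k=n+2$. If $n\ge d-1$, then $C^{(1,d)}_{j,\ell(n+1,k)}=0$ in each of the following cases: - $j<d-1+d(n+2-d)$ and $1\le k\le d$; - $j>nd$ and $1\le k\le d-2$; - $j>nd+1$ and $k=d-1$; - $j>(n+1)d$ and $k=d$.
   Context: Let $w$ be a non-negative weight function whose support is an interval $I=(a,b)$, $(a,\infty)$ or $(-\infty,\infty)$, with all moments finite, and $\phi$ a real polynomial of degree $d$. Let $\gamma_{1,d}=\{(x,y):y=\phi(x),x\in I\}$; polynomials are considered in $\mathbb{R}[x,y]/\langle y-\phi(x)\rangle$ with inner product $\langle f,g\rangle_{\gamma_{1,d},w}=\int_I f(x,\phi(x))g(x,\phi(x))w(x)\,dx$. Let $P^{(1,d)}_{n,0}=p_n(w;x)$, $n\ge0$, be the orthonormal polynomials for $w$ with positive leading coefficients. Orthonormal OPs $Y^{(1,d)}_{n,k}$, $n\ge0$, $1\le k\le\min\{n+1,d\}$, are constructed as follows (''orthogonalising $f$'' means subtracting from $f$ its orthogonal projection onto the span of all previously constructed OPs and dividing by the norm of the result). $Y^{(1,d)}_{0,1}=P^{(1,d)}_{0,0}$. For $0\le n\le d-2$: orthogonalise $xY^{(1,d)}_{n,k}$ to get $Y^{(1,d)}_{n+1,k}$, in the order $k=1,\dots,n+1$,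 then orthogonalise $yY^{(1,d)}_{n,n+1}$ to get $Y^{(1,d)}_{n+1,n+2}$. For $n\ge d-1$: orthogonalise $yY^{(1,d)}_{n,k}$ to get $Y^{(1,d)}_{n+1,k}$, in the order $k=1,\dots,d$. (These are OPs of degree $n$ on $\gamma_{1,d}$: degree meaning the lowest total degree among representatives modulo $y-\phi(x)$.) $\ell(n,k)=\frac{n(n+1)}2+k-1$ for $0\le n\le d-1$, $1\le k\le n+1$, and $\ell(n,k)=dn-\frac{d(d-1)}2+k-1$ for $n\ge d$, $1\le k\le d$. The connection coefficients are $C^{(1,d)}_{j,\ell(n,k)}=\langle Y^{(1,d)}_{n,k},P^{(1,d)}_{j,0}\rangle_{\gamma_{1,d},w}$, $j\ge0$, so that $Y^{(1,d)}_{n,k}=\sum_{j\ge0}C^{(1,d)}_{j,\ell(n,k)}P^{(1,d)}_{j,0}$. *)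

(* Defs.v *)
From HB Require Import structures.
From mathcomp Require Import all_boot all_order all_algebra.
From mathcomp Require Import all_classical all_reals all_analysis.
From mathcomp Require Import zify.
Set Implicit Arguments.
Unset Strict Implicit.
Unset Printing Implicit Defensive.
Import Order.TTheory GRing.Theory Num.Theory.
Import numFieldNormedType.Exports.
Local Open Scope classical_set_scope.
Local Open Scope ring_scope.

Section Weight.
Variable R : realType.
Local Notation mu := (@lebesgue_measure R).
Implicit Types (I : set R) (w : R -> R) (p : nat -> {poly R}).

Definition weight_interval I : Prop :=
  [\/ exists a b : R, a < b /\ I = [set` `]a, b[],
      exists a : R, I = [set` `]a, +oo[]
    | I = setT].

(* The support of a weight is that of the measure w(x)dx: a weight may be
   modified on a null set. It is always closed, so "the support of w is the
   interval I" reads [weight_support w = closure I]. *)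
Definition weight_support w : set R :=
  [set x | forall U : set R, open U -> U x ->
     (0 < \int[mu]_(y in U) (w y)%:E)%E].

Definition is_weight I w : Prop :=
  [/\ measurable_fun setT w,
      forall x, 0 <= w x,
      weight_support w = closure I
    & forall n : nat, mu.-integrable I (fun x => (x ^+ n * w x)%:E)].

Definition orthonormal_polys I w p : Prop :=
  [/\ forall n, size (p n) = n.+1,
      forall n, 0 < lead_coef (p n)
    & forall m n, \int[mu]_(x in I) ((p m).[x] * (p n).[x] * w x)
                  = (m == n)%:R].

End Weight.

(* R[x,y]/<y - phi(x)>: the outer variable of {poly {poly R}} is y. *)
Definition curve_ring (R : realType) (phi : {poly R}) :=
  {poly %/ ('X - phi%:P : {poly {poly R}})}.

HB.instance Definition _ (R : realType) (phi : {poly R}) :=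
  GRing.ComNzRing.on (curve_ring phi).
HB.instance Definition _ (R : realType) (phi : {poly R}) :=
  GRing.Algebra.on (curve_ring phi).

Section Curve.
Variables (R : realType) (phi : {poly R}).
Local Notation mu := (@lebesgue_measure R).
Implicit Types (I : set R) (w : R -> R) (f g : curve_ring phi).

Definition curve_class (q : {poly {poly R}}) : curve_ring phi :=
  in_qpoly ('X - phi%:P) q.

Definition curve_x : curve_ring phi := curve_class ('X)%:P.
Definition curve_y : curve_ring phi := curve_class 'X.

(* The value f(x, phi(x)), computed on the canonical representative; any other
   one gives the same value, see [curve_eval_class]. *)
Definition curve_eval f (x : R) : R :=
  (f : {poly {poly R}}).[(phi.[x])%:P].[x].

Lemma curve_eval_class (q : {poly {poly R}}) (x : R) :
  curve_eval (curve_class q) x = q.[(phi.[x])%:P].[x].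
Proof.
have hm : 'X - phi%:P \is monic by exact: monicXsubC.
have mkE : mk_monic ('X - phi%:P) = 'X - phi%:P.
  by rewrite /mk_monic size_XsubC hm.
rewrite /curve_eval /curve_class /= mkE.
rewrite [in RHS](Pdiv.RingMonic.rdivp_eq hm q) !hornerE.
by rewrite subrr mulr0 add0r.
Qed.

Definition curve_dot I w f g : R :=
  \int[mu]_(x in I) (curve_eval f x * curve_eval g x * w x).

Definition curve_norm I w f : R := Num.sqrt (curve_dot I w f f).

(* Scaling by a real number c is scaling by the constant polynomial c%:P. *)
Definition real_span (S : set (curve_ring phi)) : set (curve_ring phi) :=
  [set f | exists (m : nat) (c : 'I_m -> R) (h : 'I_m -> curve_ring phi),
     (forall i, S (h i)) /\ f = \sum_(i < m) (c i)%:P *: h i].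

Definition orthogonal_projection I w (S : set (curve_ring phi)) f q : Prop :=
  real_span S q /\ forall s, real_span S s -> curve_dot I w (f - q) s = 0.

Definition orthogonalisation I w (S : set (curve_ring phi)) f g : Prop :=
  exists2 q, orthogonal_projection I w S f q &
    g = ((curve_norm I w (f - q))^-1)%:P *: (f - q).

End Curve.

Arguments curve_x {R} phi.
Arguments curve_y {R} phi.
Arguments curve_class {R} phi q.

Definition OP_index (d n k : nat) : bool := (1 <= k <= minn n.+1 d)%N.

(* The OP of index (i, l) is constructed before that of index (n, k). *)
Definition OP_before (d n k i l : nat) : bool :=
  OP_index d i l && ((i < n)%N || (i == n) && (l < k)%N).

Definition ell (d n k : nat) : nat :=
  if (n < d)%N then ((n * n.+1) %/ 2 + k.-1)%N
  else (d * n - (d * (d - 1)) %/ 2 + k.-1)%N.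

Section OPs.
Variables (R : realType) (I : set R) (w : R -> R) (phi : {poly R}) (d : nat).
Variable p : nat -> {poly R}.
Variable Y : nat -> nat -> curve_ring phi.

Definition curve_P (n : nat) : curve_ring phi := curve_class phi (p n)%:P.

Definition previous_OPs (n k : nat) : set (curve_ring phi) :=
  [set f | exists i l, OP_before d n k i l /\ f = Y i l].

(* Only the values Y n k with [OP_index d n k] are constrained. *)
Definition curve_OPs : Prop :=
  [/\ Y 0%N 1%N = curve_P 0,
      forall n k, (n.+2 <= d)%N -> (1 <= k <= n.+1)%N ->
        orthogonalisation I w (previous_OPs n.+1 k)
          (curve_x phi * Y n k) (Y n.+1 k),
      forall n, (n.+2 <= d)%N ->
        orthogonalisation I w (previous_OPs n.+1 n.+2)
          (curve_y phi * Y n n.+1) (Y n.+1 n.+2)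
    & forall n k, (d <= n.+1)%N -> (1 <= k <= d)%N ->
        orthogonalisation I w (previous_OPs n.+1 k)
          (curve_y phi * Y n k) (Y n.+1 k)].

(* C_{j,l} := <Y_{n,k}, P_{j,0}> for the unique index (n, k) with
   ell(n, k) = l, see [conn_coefE]. *)
Definition conn_coef (j l : nat) : R :=
  if [pick a : 'I_l.+1 * 'I_d.+1 | OP_index d a.1 a.2 && (ell d a.1 a.2 == l)]
  is Some a then curve_dot I w (Y a.1 a.2) (curve_P j) else 0.

End OPs.

Lemma ellE d n k : (0 < d)%N ->
  ell d n k = (\sum_(0 <= i < n) minn i.+1 d + k.-1)%N.
Proof.
move=> d0.
have tri m : (m <= d)%N -> (\sum_(0 <= i < m) minn i.+1 d = (m * m.+1) %/ 2)%N.
  elim: m => [|m IH] md; first by rewrite big_geq.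
  rewrite big_nat_recr //= IH; last exact: ltnW.
  rewrite (minn_idPl md).
  have -> : (m.+1 * m.+2 = m.+1 * 2 + m * m.+1)%N by nia.
  by rewrite divnMDl // addnC.
rewrite /ell; case: ltnP => nd; congr addn; first by rewrite tri // ltnW.
have -> : (\sum_(0 <= i < n) minn i.+1 d = (d * d.+1) %/ 2 + d * (n - d))%N.
  rewrite (big_cat_nat _ (n := d)) //= tri //; congr addn.
  rewrite (eq_big_nat _ _ (F2 := fun=> d)); last first.
    by move=> i /andP[di _]; apply/minn_idPr; rewrite (leq_trans di).
  by rewrite sum_nat_const_nat mulnC.
have e1 : (d * d.+1 = d * 2 + d * (d - 1))%N by nia.
rewrite e1 divnMDl //.
have e2 : ((d * (d - 1)) %/ 2 * 2 = d * (d - 1))%N.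
  apply/eqP; rewrite -dvdn_eq dvdn2; case: (d) => // m.
  by rewrite subn1 /= oddM /=; case: (odd m).
nia.
Qed.

Lemma ell_inj d n k n' k' : (0 < d)%N -> OP_index d n k -> OP_index d n' k' ->
  ell d n k = ell d n' k' -> n = n' /\ k = k'.
Proof.
move=> d0 v v'; rewrite !ellE //.
have lt_row m l m' l' : OP_index d m l -> (m < m')%N ->
    (\sum_(0 <= i < m) minn i.+1 d + l.-1 <
     \sum_(0 <= i < m') minn i.+1 d + l'.-1)%N.
  move=> /andP[l1 l2] mm'.
  rewrite (big_cat_nat _ (n := m.+1) (p := m')) //= big_nat_recr //=.
  set a := bigop _ _ _; set b := bigop _ _ _.
  have : (0 < minn m.+1 d)%N by rewrite (leq_trans l1).
  by lia.
have [nn'|nn'|->] := ltngtP n n'.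
- by move/eqP; rewrite ltn_eqF // lt_row.
- by move/eqP; rewrite gtn_eqF // lt_row.
- by move/addnI; move: v v' => /andP[? _] /andP[? _] ?; split=> //; lia.
Qed.

Lemma conn_coefE (R : realType) (I : set R) w (phi : {poly R}) d p
    (Y : nat -> nat -> curve_ring phi) (j n k : nat) :
  (0 < d)%N -> OP_index d n k ->
  conn_coef I w d p Y j (ell d n k) = curve_dot I w (Y n k) (curve_P phi p j).
Proof.
move=> d0 v; rewrite /conn_coef; case: pickP => [[a b] /= /andP[va /eqP e]|].
  by have [-> ->] := ell_inj d0 va v e.
have nl : (n < (ell d n k).+1)%N.
  rewrite ltnS ellE //; apply: leq_trans (leq_addr _ _).
  rewrite -[X in (X <= _)%N](_ : \sum_(0 <= i < n) 1 = n)%N.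
    by apply: leq_sum => i _; rewrite leq_min d0.
  by rewrite sum_nat_const_nat subn0 muln1.
have kd : (k < d.+1)%N.
  by move: v; rewrite /OP_index leq_min => /and3P[].
by move/(_ (Ordinal nl, Ordinal kd)); rewrite /= v eqxx.
Qed.

(* Main.v *)
Require Import Defs.
From mathcomp Require Import all_boot all_order all_algebra.
From mathcomp Require Import all_classical all_reals all_analysis.
From mathcomp Require Import zify ring.
Set Implicit Arguments.
Unset Strict Implicit.
Unset Printing Implicit Defensive.
Import Order.TTheory GRing.Theory Num.Theory.
Local Open Scope classical_set_scope.
Local Open Scope ring_scope.

(** Modulo y - phi(x) every element of the curve ring is a polynomial in x
    alone, its restriction to the curve, and the inner product of the curve is
    the weighted inner product of these restrictions. So everything can be read
    in R[x], with y acting as multiplication by phi.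

    To the index (n, k) attach the monomial M(n, k) = x^i phi^j, where
    i = min(n, d-1) - (k-1) and j = max(n-(d-1), 0) + (k-1), so that i + j = n
    and i < d. The construction of Y(n+1, k) multiplies an earlier Y(n, l) by
    x or y, and M(n+1, k) is the product of M(n, l) by the same factor; moreover
    this factor sends every monomial that precedes (n, l) to a monomial that
    precedes (n+1, k). By induction along the order of construction, the M that
    precede an index therefore lie in the span of the Y that precede it
    [triangular_earlier], and Y(n, k) lies in the span of the M up to (n, k)
    [triangular_up_to]. An orthogonalised vector of norm zero does no harm: the
    inner product being definite, that vector already lies in the span of the
    earlier ones.

    Both halves of the result are now statements about degrees of monomials.
    The degree of x^i phi^j is i + d j. The restriction of Y(n+1, k) has degree
    at most that of the largest monomial up to (n+1, k), which is at most n d or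
    attained in row n+1 [size_up_to], and p_j is orthogonal to all polynomials
    of degree below j; this gives the vanishing for large j [conn_coef_high].
    Conversely every degree e is that of exactly one x^i phi^j with i < d, given
    by the Euclidean division of e by d. If for each e <= j this monomial sits
    in a row <= n, then p_j is in the span of the M, hence of the Y, that
    precede (n+1, k), to which Y(n+1, k) is orthogonal; this gives the vanishing
    for small j [conn_coef_low]. *)

(** * Linear spans *)

Section LinearSpan.
Variables (K : nzRingType) (E : lmodType K).
Implicit Types S T V : set E.

Definition is_subspace V : Prop :=
  [/\ V 0, forall f g, V f -> V g -> V (f + g)
    & forall c f, V f -> V (c *: f)].

(** Encoded as the intersection of the subspaces that contain [S]: a property
    that holds on [S] and defines a subspace then holds on the span without
    any handling of linear combinations. *)
Definition lspan S : set E :=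
  [set f | forall V, is_subspace V -> S `<=` V -> V f].

Lemma lspan_subspace S : is_subspace (lspan S).
Proof.
split=> [V [V0 _ _] _ //|f g Sf Sg V sV SV|c f Sf V sV SV].
  by case: (sV) => _ VD _; apply: VD; [apply: Sf|apply: Sg].
by case: (sV) => _ _ VZ; apply: VZ; apply: Sf.
Qed.

Lemma sub_lspan S : S `<=` lspan S.
Proof. by move=> f Sf V _; apply. Qed.

Lemma lspan_min S V : is_subspace V -> S `<=` V -> lspan S `<=` V.
Proof. by move=> sV SV f; apply. Qed.

Lemma lspan_sub S T : S `<=` lspan T -> lspan S `<=` lspan T.
Proof. by move=> ST; apply: lspan_min => //; apply: lspan_subspace. Qed.

Lemma lspanS S T : S `<=` T -> lspan S `<=` lspan T.
Proof. by move=> ST; apply: lspan_sub; apply: subset_trans (@sub_lspan T). Qed.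

End LinearSpan.

(** * Families built from one another by multiplication *)

Section Triangularity.
Variables (K : comNzRingType) (E : algType K).
Variables (J : Type) (before : J -> J -> Prop) (rank : J -> nat) (D : set J).
Hypothesis before_rank : forall i j, before i j -> (rank i < rank j)%N.
Hypothesis before_dom : forall i j, before i j -> D i.
Hypothesis before_trans : forall i j k, before i j -> before j k -> before i k.

Definition earlier (F : J -> E) j : set E := F @` [set i | before i j].
Definition up_to (F : J -> E) j : set E := F j |` earlier F j.

Lemma up_to_earlier F i j : before i j -> up_to F i `<=` earlier F j.
Proof.
move=> ij f [->|[i' i'i <-]]; first by exists i.
by exists i' => //; apply: before_trans ij.
Qed.

Variables M Y : J -> E.

Definition base_step j : Prop := lspan [set Y j] (M j) /\ lspan [set M j] (Y j).

(** [Y j] arises from the earlier [Y i] by multiplying by [g] and then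
    correcting by earlier vectors. The condition on [i'] is what carries the
    correction terms hidden in [Y i] over to terms that precede [j]. *)
Definition inductive_step j : Prop :=
  exists i g, [/\ before i j, M j = g * M i,
    forall i', before i' i -> exists2 j', before j' j & M j' = g * M i',
    lspan (up_to Y j) (g * Y i) & lspan (g * Y i |` earlier Y j) (Y j)].

Hypothesis steps : forall j, D j -> base_step j \/ inductive_step j.

Lemma mul_lspan (g : E) S T :
  (forall f, S f -> lspan T (g * f)) -> forall f, lspan S f -> lspan T (g * f).
Proof.
move=> ST f; move: f.
have [T0 TD TZ] := lspan_subspace T.
apply: (@lspan_min _ _ _ [set f | lspan T (g * f)]) => //; split=> /=.
- by rewrite mulr0.
- by move=> f f' Tf Tf'; rewrite mulrDr; apply: TD.
- by move=> c f Tf; rewrite -scalerAr; apply: TZ.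
Qed.

(** Both inclusions have to be carried along the induction. To reach
    [M j = g * M i], write [M i] as a multiple of [Y i] plus earlier vectors:
    [g * Y i] is in the span of the [Y] up to [j], whereas for the earlier
    vectors one passes to the [M], where [g] acts by a shift of indices, and
    back to the [Y]. The other inclusion is similar. *)
Lemma triangular_up_to j : D j -> lspan (up_to Y j) (M j) /\ lspan (up_to M j) (Y j).
Proof.
have [m] := ubnP (rank j); elim: m j => // m IH j jm Dj.
have {}IH i : before i j -> lspan (up_to Y i) (M i) /\ lspan (up_to M i) (Y i).
  move=> ij; apply: IH (before_dom ij).
  by apply: leq_trans (before_rank ij) _; rewrite -ltnS.
have YM i : before i j -> lspan (earlier Y i) `<=` lspan (earlier M i).
  move=> ij; apply: lspan_sub => _ [i' i'i <-].
  have [_ h] := IH _ (before_trans i'i ij).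
  by apply: lspanS h; apply: up_to_earlier.
have MYj : lspan (earlier M j) `<=` lspan (earlier Y j).
  apply: lspan_sub => _ [i ij <-]; have [h _] := IH _ ij.
  by apply: lspanS h; apply: up_to_earlier.
have YMj : lspan (earlier Y j) `<=` lspan (earlier M j).
  apply: lspan_sub => _ [i ij <-]; have [_ h] := IH _ ij.
  by apply: lspanS h; apply: up_to_earlier.
have [[bM bY]|[i [g [ij Mj shift gYi Yj]]]] := steps Dj.
  by split; [apply: lspanS bM | apply: lspanS bY] => f fE; left.
have g_earlier f : lspan (earlier M i) f -> lspan (earlier M j) (g * f).
  apply: mul_lspan => _ [i' i'i <-].
  have [j' j'j <-] := shift _ i'i.
  by apply: sub_lspan; exists j'.
have earlier_up F : lspan (earlier F j) `<=` lspan (up_to F j).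
  by apply: lspanS => f; right.
split.
  rewrite Mj; apply: mul_lspan (IH _ ij).1 => f [->//|Yf].
  by apply: earlier_up; apply: MYj; apply: g_earlier; apply: (YM _ ij); apply: sub_lspan.
apply: lspan_sub Yj => f [->|Yf]; last first.
  by apply: earlier_up; apply: YMj; apply: sub_lspan.
apply: mul_lspan (IH _ ij).2 => h [->|Mh].
  by rewrite -Mj; apply: sub_lspan; left.
by apply: earlier_up; apply: g_earlier; apply: sub_lspan.
Qed.

Lemma triangular_earlier j : lspan (earlier M j) `<=` lspan (earlier Y j).
Proof.
apply: lspan_sub => _ [i ij <-].
have [h _] := triangular_up_to (before_dom ij).
by apply: lspanS h; apply: up_to_earlier.
Qed.

End Triangularity.

(** * Polynomials of bounded degree *)

Section GradedPolynomials.
Variable F : fieldType.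
Implicit Types (f g h : {poly F}) (V : set {poly F}).

Lemma poly_top_reduction h f n : size h = n.+1 -> (size f <= n.+1)%N ->
  exists c g, f = c *: h + g /\ (size g <= n)%N.
Proof.
move=> sh sf; exists (f`_n / h`_n), (f - (f`_n / h`_n) *: h).
split; first by rewrite addrC subrK.
have hn0 : h`_n != 0 by rewrite -[n]/(n.+1.-1) -sh lead_coef_eq0 -size_poly_eq0 sh.
apply/leq_sizeP => i; rewrite coefB coefZ leq_eqVlt => /predU1P[<-|ni].
  by rewrite divfK // subrr.
by rewrite (nth_default _ (leq_trans sf ni)) [h`_i]nth_default ?sh // mulr0 subrr.
Qed.

Lemma subspace_poly_small V n : is_subspace V ->
  (forall s, (s < n)%N -> exists2 h, V h & size h = s.+1) ->
  forall f, (size f <= n)%N -> V f.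
Proof.
move=> [V0 VD VZ]; elim: n => [_ f|n IH Vs f sf].
  by rewrite leqn0 size_poly_eq0 => /eqP->.
have [h Vh sh] := Vs n (ltnSn n).
have [c [g [-> sg]]] := poly_top_reduction sh sf.
by apply: VD; [exact: VZ | apply: IH sg => s sn; apply: Vs; exact: ltnW].
Qed.

Lemma subspace_size_le n : is_subspace [set f : {poly F} | (size f <= n)%N].
Proof.
split=> /= [|f g sf sg|c f]; first by rewrite size_poly0.
  by rewrite (leq_trans (size_polyD _ _)) // geq_max sf.
by apply: leq_trans; apply: size_scale_leq.
Qed.

End GradedPolynomials.

(** * The weighted inner product of polynomials *)

Section WeightedDot.
Variables (R : realType) (I : set R) (w : R -> R).
Local Notation mu := (@lebesgue_measure R).
Hypothesis mI : measurable I.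
Hypothesis moments : forall n, mu.-integrable I (fun x => (x ^+ n * w x)%:E).
Implicit Types f g h : {poly R}.

Definition pdot f g : R := \int[mu]_(x in I) (f.[x] * g.[x] * w x).

Lemma poly_integrable f : mu.-integrable I (EFin \o (fun x => f.[x] * w x)).
Proof.
have -> : EFin \o (fun x => f.[x] * w x) =
    (fun x => \sum_(i < size f) (f`_i)%:E * (x ^+ i * w x)%:E)%E.
  apply/funext => x /=; rewrite horner_coef mulr_suml -sumEFin.
  by apply: eq_bigr => i _; rewrite -EFinM mulrA.
by apply: integrable_sum => // i _; apply: integrableZl.
Qed.

Lemma pdotE f g : pdot f g = \int[mu]_(x in I) ((f * g).[x] * w x).
Proof. by apply: eq_Rintegral => x _; rewrite hornerM. Qed.

Lemma pdotC f g : pdot f g = pdot g f.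
Proof. by rewrite !pdotE mulrC. Qed.

Lemma pdotDl f g h : pdot (f + g) h = pdot f h + pdot g h.
Proof.
rewrite !pdotE -RintegralD //; try exact: poly_integrable.
by apply: eq_Rintegral => x _; rewrite mulrDl hornerD mulrDl.
Qed.

Lemma pdotZl c f h : pdot (c *: f) h = c * pdot f h.
Proof.
rewrite !pdotE -RintegralZl //; try exact: poly_integrable.
by apply: eq_Rintegral => x _; rewrite -scalerAl hornerZ mulrA.
Qed.

Lemma pdotDr f g h : pdot f (g + h) = pdot f g + pdot f h.
Proof. by rewrite !(pdotC f) pdotDl. Qed.

Lemma pdotZr c f h : pdot f (c *: h) = c * pdot f h.
Proof. by rewrite !(pdotC f) pdotZl. Qed.

Lemma subspace_orthogonal f : is_subspace [set g | pdot f g = 0].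
Proof.
split=> /= [|g h fg fh|c g fg]; last by rewrite pdotZr fg mulr0.
  by rewrite -(scale0r (0 : {poly R})) pdotZr mul0r.
by rewrite pdotDr fg fh addr0.
Qed.

Variable p : nat -> {poly R}.
Hypothesis hp : orthonormal_polys I w p.

Lemma orthonormal_low f n : (size f <= n)%N -> pdot (p n) f = 0.
Proof.
have [sp _ op] := hp.
apply: (subspace_poly_small (subspace_orthogonal (p n))) => s sn.
exists (p s) => //=; rewrite /pdot op.
by rewrite gtn_eqF.
Qed.

(** Splitting off the top component, [f = c *: p n + g] with [g] of lower
    degree, gives [pdot f f = c ^+ 2 + pdot g g]; so the orthonormal basis
    already forces definiteness. *)
Lemma pdot_definite f : f != 0 -> 0 < pdot f f.
Proof.
suff: forall n, (size f <= n)%N -> f = 0 \/ 0 < pdot f f.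
  by case/(_ _ (leqnn _)) => // ->; rewrite eqxx.
move=> n; elim: n f => [f|n IH f sf].
  by rewrite leqn0 size_poly_eq0 => /eqP; left.
have [sp _ op] := hp.
have [c [g [fE sg]]] := poly_top_reduction (sp n) sf.
have [c0|c0] := eqVneq c 0.
  by move: fE; rewrite c0 scale0r add0r => ->; apply: IH.
right; have -> : pdot f f = c ^+ 2 + pdot g g.
  rewrite fE !(pdotDl, pdotDr, pdotZl, pdotZr) (pdotC g (p n)).
  rewrite (orthonormal_low sg) [pdot (p n) (p n)]op eqxx /=; ring.
have [->|g0] := IH _ sg; last by rewrite addr_gt0 // exprn_even_gt0.
have [-> _ _] := subspace_orthogonal 0.
by rewrite addr0 exprn_even_gt0.
Qed.

End WeightedDot.

(** * Restriction to the curve *)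

Section CurveAsPolynomials.
Variables (R : realType) (phi : {poly R}).
Implicit Types f g : curve_ring phi.

Definition restrict f : {poly R} := (f : {poly {poly R}}).[phi].

Lemma restrict_class (q : {poly {poly R}}) :
  restrict (curve_class phi q) = q.[phi].
Proof.
have hm : 'X - phi%:P \is monic by exact: monicXsubC.
have mkE : mk_monic ('X - phi%:P) = 'X - phi%:P.
  by rewrite /mk_monic size_XsubC hm.
rewrite /restrict /curve_class /= mkE.
rewrite [in RHS](Pdiv.RingMonic.rdivp_eq hm q) !hornerE.
by rewrite subrr mulr0 add0r.
Qed.

Lemma restrictM f g : restrict (f * g) = restrict f * restrict g.
Proof. by rewrite -hornerM -restrict_class. Qed.

Lemma restrictD f g : restrict (f + g) = restrict f + restrict g.
Proof. by rewrite /restrict poly_of_qpolyD hornerD. Qed.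

Lemma restrictZ (c : {poly R}) f : restrict (c *: f) = c * restrict f.
Proof. by rewrite /restrict /= hornerZ. Qed.

Lemma restrictB f g : restrict (f - g) = restrict f - restrict g.
Proof. by rewrite -scaleN1r restrictD restrictZ mulN1r. Qed.

Lemma curve_evalE f x : curve_eval f x = (restrict f).[x].
Proof.
rewrite /curve_eval /restrict; elim/poly_ind: (f : {poly {poly R}}) => [|q c IH].
  by rewrite !horner0.
by rewrite !hornerE IH.
Qed.

Lemma real_span_subspace (S : set (curve_ring phi)) :
  is_subspace (restrict @` real_span S).
Proof.
split.
- exists 0; last by rewrite -(scale0r 0) restrictZ mul0r.
  exists 0%N, (fun=> 0), (fun=> 0); split; first by case.
  by rewrite big_ord0.
- move=> _ _ [f [m [c [h [Sh ->]]]] <-] [g [n [b [k [Sk ->]]]] <-].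
  rewrite -restrictD; eexists; last reflexivity.
  exists (m + n)%N, (fun i : 'I_(m + n) =>
    match fintype.split i with inl i => c i | inr i => b i end).
  exists (fun i : 'I_(m + n) =>
    match fintype.split i with inl i => h i | inr i => k i end).
  split=> [i|]; first by case: (fintype.split i).
  rewrite big_split_ord /=; congr (_ + _); apply: eq_bigr => i _.
    by rewrite (unsplitK (inl i)).
  by rewrite (unsplitK (inr i)).
- move=> a _ [f [m [c [h [Sh ->]]]] <-].
  exists (a%:P *: \sum_(i < m) (c i)%:P *: h i); last by rewrite restrictZ mul_polyC.
  exists m, (fun i => a * c i), h; split=> //.
  by rewrite scaler_sumr; apply: eq_bigr => i _; rewrite scalerA polyCM.
Qed.

Lemma real_spanE (S : set (curve_ring phi)) :
  restrict @` real_span S = lspan (restrict @` S).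
Proof.
apply/seteqP; split=> [_ [f [m [c [h [Sh ->]]]] <-]|].
  have [S0 SD SZ] := lspan_subspace (restrict @` S).
  elim/big_ind: _ => [|f1 f2 Sf1 Sf2|i _].
  - by rewrite -(scale0r 0) restrictZ mul0r.
  - by rewrite restrictD; apply: SD.
  - by rewrite restrictZ mul_polyC; apply: SZ; apply: sub_lspan; exists (h i).
apply: lspan_min; first exact: real_span_subspace.
move=> _ [f Sf <-]; exists f => //.
exists 1%N, (fun=> 1), (fun=> f); split=> //.
by rewrite big_ord1 scale1r.
Qed.

Variables (I : set R) (w : R -> R).

Lemma curve_dotE f g : curve_dot I w f g = pdot I w (restrict f) (restrict g).
Proof. by apply: eq_Rintegral => x _; rewrite !curve_evalE. Qed.

Hypothesis mI : measurable I.
Hypothesis moments : forall n,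
  (@lebesgue_measure R).-integrable I (fun x => (x ^+ n * w x)%:E).
Variable p : nat -> {poly R}.
Hypothesis hp : orthonormal_polys I w p.

(** The first conclusion includes the degenerate case of a residual
    [f - q] of norm zero, where [g] is zero: by definiteness [f] then restricts
    to the same polynomial as its projection [q]. *)
Lemma orthogonalisationE (S : set (curve_ring phi)) f g :
  orthogonalisation I w S f g ->
  [/\ lspan (restrict g |` restrict @` S) (restrict f),
      lspan (restrict f |` restrict @` S) (restrict g)
    & forall h, lspan (restrict @` S) h -> pdot I w (restrict g) h = 0].
Proof.
move=> [q [Sq qorth] ->]; rewrite restrictZ mul_polyC restrictB.
set c := (curve_norm _ _ _)^-1.
have {}Sq : lspan (restrict @` S) (restrict q).
  by rewrite -real_spanE; exists q.
have Sadj (f0 f1 : {poly R}) : lspan (restrict @` S) f1 ->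
    lspan (f0 |` restrict @` S) f1 by apply: lspanS => k; right.
have adj (f0 : {poly R}) : lspan (f0 |` restrict @` S) f0.
  by apply: sub_lspan; left.
split.
- have [r0|r0] := eqVneq (restrict f - restrict q) 0.
    by rewrite (subr0_eq r0); apply: Sadj.
  have cn0 : c != 0.
    rewrite invr_eq0 /curve_norm curve_dotE restrictB sqrtr_eq0 -ltNge.
    exact: (pdot_definite mI moments hp).
  have [_ SD SZ] := lspan_subspace ((c *: (restrict f - restrict q)) |` restrict @` S).
  have {2}-> : restrict f = c^-1 *: (c *: (restrict f - restrict q)) + restrict q.
    by rewrite scalerA mulVf // scale1r subrK.
  by apply: SD; [apply: SZ; apply: adj | apply: Sadj].
- have [_ SD SZ] := lspan_subspace (restrict f |` restrict @` S).
  apply: (SZ); apply: SD; first exact: adj.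
  by rewrite -scaleN1r; apply: SZ; apply: Sadj.
- move=> h; rewrite -real_spanE => -[s Ss <-].
  by rewrite pdotZl // -restrictB -curve_dotE qorth // mulr0.
Qed.

End CurveAsPolynomials.

Arguments restrict {R phi} f.

(** * Monomials on the curve *)

Section Monomials.
Variables (R : realType) (phi : {poly R}) (d : nat).
Implicit Types a b : nat * nat.

Definition before a b : bool := OP_before d b.1 b.2 a.1 a.2.

(** In row [n <= d - 1] the exponents run over all pairs of sum [n]; in later
   rows the exponent of [x] is kept below [d], starting from [d - 1]. The
   truncated subtraction [n - d.-1] merges both cases. *)
Definition yexp a : nat := (a.1 - d.-1 + a.2.-1)%N.
Definition xexp a : nat := (minn a.1 d.-1 - a.2.-1)%N.
Definition monomial a : {poly R} := 'X^(xexp a) * phi ^+ yexp a.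

Lemma xexp_yexp a : OP_index d a.1 a.2 -> (xexp a + yexp a = a.1)%N.
Proof. by case: a => n k; rewrite /OP_index /xexp /yexp /=; lia. Qed.

(** The factor [d.+1] exceeds every second index, so that the rank orders the
   indices lexicographically. *)
Definition before_rank a : nat := (a.1 * d.+1 + a.2)%N.

Lemma before_rankP a b : before a b -> (before_rank a < before_rank b)%N.
Proof.
rewrite /before /before_rank /OP_before /OP_index.
move: a b => [n k] [m l] /=; nia.
Qed.

Lemma before_dom a b : before a b -> OP_index d a.1 a.2.
Proof. by case/andP. Qed.

Lemma before_trans a b c : before a b -> before b c -> before a c.
Proof. by rewrite /before /OP_before /OP_index; lia. Qed.

Lemma monomial_y_step a b : b.1 = a.1.+1 ->
  (if (d <= a.1.+1)%N then b.2 = a.2 else b.2 = a.2.+1) ->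
  OP_index d a.1 a.2 -> monomial b = phi * monomial a.
Proof.
move: a b => [n k] [m l] /= ->; rewrite /OP_index => h v.
rewrite /monomial mulrCA -exprS; congr ('X^_ * phi ^+ _).
  rewrite /xexp /=.
  by move: h; case: leqP => ? ->; lia.
rewrite /yexp /=.
by move: h; case: leqP => ? ->; lia.
Qed.

Lemma monomial_x_step a : (a.1.+2 <= d)%N -> OP_index d a.1 a.2 ->
  monomial (a.1.+1, a.2) = 'X * monomial a.
Proof.
case: a => [n k] /= nd v; rewrite /monomial mulrA -exprS.
congr ('X^_ * phi ^+ _); first by rewrite /xexp /=; move: v; rewrite /OP_index; lia.
by rewrite /yexp /=; lia.
Qed.

Lemma x_shift n k a : (n.+2 <= d)%N -> (1 <= k <= n.+1)%N -> before a (n, k) ->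
  exists2 b, before b (n.+1, k) & monomial b = 'X * monomial a.
Proof.
move=> nd kn an; exists (a.1.+1, a.2).
  by move: a an => [i l]; rewrite /before /OP_before /OP_index /=; lia.
apply: monomial_x_step (before_dom an).
by move: a an => [i l]; rewrite /before /OP_before /OP_index /=; lia.
Qed.

(** Multiplication by [y] shifts the second index in the rows below [d - 1],
    where the next row is longer by one, and keeps it in the later rows. For
    [n.+1 < d] only the last index of row [n] is used: its image [n.+2] is the
    last one of row [n.+1], after the images of all earlier indices. *)
Lemma y_shift n k m a : OP_index d n k -> 
  (if (d <= n.+1)%N then m = k else k = n.+1 /\ m = n.+2) -> before a (n, k) ->
  exists2 b, before b (n.+1, m) & monomial b = phi * monomial a.
Proof.
move=> v h an; exists (a.1.+1, if (d <= a.1.+1)%N then a.2 else a.2.+1).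
  move: a an v => [i l]; rewrite /before /OP_before /OP_index /=.
  case: (leqP d n.+1) h => [dn ->|nd [-> ->]]; case: (leqP d i.+1) => di; lia.
apply: monomial_y_step (before_dom an) => //=.
by case: leqP.
Qed.

Hypotheses (hd : (3 <= d)%N) (hphi : size phi = d.+1).

Lemma size_monomial a : size (monomial a) = (xexp a + d * yexp a).+1.
Proof.
have phi0 : phi != 0 by rewrite -size_poly_eq0 hphi.
rewrite /monomial mulrC size_mulXn ?expf_neq0 //.
have := size_exp phi (yexp a); rewrite hphi /=.
have := polySpred (expf_neq0 (yexp a) phi0).
by move=> -> <-; rewrite addnS.
Qed.

(** The quotient and the remainder of a degree [e] by [d] are the exponents of
    the monomial of degree [e], and their sum is its row. *)
Lemma low_degree_span n k D (f : {poly R}) :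
  (forall e, (e < D)%N -> (e %% d + e %/ d <= n)%N) -> (size f <= D)%N ->
  lspan (earlier before monomial (n.+1, k)) f.
Proof.
move=> hD; apply: subspace_poly_small; first exact: lspan_subspace.
move=> e eD; have := hD e eD; set r := (e %% d)%N; set q := (e %/ d)%N => rqn.
have rd : (r < d)%N by rewrite ltn_mod; lia.
have eE : e = (q * d + r)%N := divn_eq e d.
(* The inverse of the exponent map: row [r + q], and the second index for
   which [xexp] is [r]. *)
pose a := ((r + q)%N, (minn (r + q) d.-1 - r).+1).
have xa : xexp a = r by rewrite /xexp /a /=; lia.
have ya : yexp a = q by rewrite /yexp /a /=; lia.
exists (monomial a); last by rewrite size_monomial xa ya eE; congr _.+1; lia.
apply: sub_lspan; exists a => //=.
by rewrite /before /OP_before /OP_index /=; lia.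
Qed.

(** In rows up to [n] the exponents sum to at most [n], so the degree is at
    most [n * d]; in row [n.+1] the degree is [n.+1 + d.-1 * yexp], which grows
    with the second index. *)
Lemma size_up_to n k t (f : {poly R}) : (yexp (n.+1, k) <= t)%N -> OP_index d n.+1 k ->
  lspan (up_to before monomial (n.+1, k)) f ->
  (size f <= (maxn (n * d) (n.+1 + d.-1 * t)).+1)%N.
Proof.
move=> yt v.
apply: (lspan_min (subspace_size_le _ _)) => _ [->|[a an <-]] /=.
  rewrite size_monomial ltnS; have /= := @xexp_yexp (n.+1, k) v.
  move: (xexp _) (yexp _) yt => x y; nia.
rewrite size_monomial ltnS; have := xexp_yexp (before_dom an).
have : (a.1 <= n)%N \/ a.1 = n.+1 /\ (yexp a <= yexp (n.+1, k))%N.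
  move: a an => [i l]; rewrite /before /OP_before /OP_index /yexp /=; lia.
move: (xexp a) (yexp a) (yexp _) yt => x y z; nia.
Qed.
End Monomials.

(** * The orthonormal polynomials on the curve *)

Section Construction.
Variables (R : realType) (I : set R) (w : R -> R) (d : nat) (phi : {poly R}).
Variables (p : nat -> {poly R}) (Y : nat -> nat -> curve_ring phi).
Hypotheses (hI : weight_interval I) (hw : is_weight I w).
Hypotheses (hd : (3 <= d)%N) (hphi : size phi = d.+1).
Hypotheses (hp : orthonormal_polys I w p) (hY : curve_OPs I w d p Y).

Let y a : {poly R} := restrict (Y a.1 a.2).

Lemma measurable_weight_interval : measurable I.
Proof.
case: hI => [[a [b [_ ->]]]|[a ->]|->]; [exact: measurable_itv..|exact: measurableT].
Qed.

Lemma weight_moments n :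
  (@lebesgue_measure R).-integrable I (fun x => (x ^+ n * w x)%:E).
Proof. by case: hw. Qed.

Let mI := measurable_weight_interval.
Let moments := weight_moments.

Lemma restrict_previous n k :
  restrict @` previous_OPs d Y n k = earlier (before d) y (n, k).
Proof.
apply/seteqP; split=> [_ [_ [i [l [b ->]]] <-]|_ [[i l] b <-]].
  by exists (i, l).
by exists (Y i l) => //; exists i, l.
Qed.

(** The three rules of the construction in one form: [g] is [x] or [y], and
    [(n, l)] is the index of the polynomial that is multiplied by it. *)
Lemma construction_step n k : OP_index d n.+1 k ->
  exists l g, [/\ before d (n, l) (n.+1, k),
    monomial phi d (n.+1, k) = g * monomial phi d (n, l),
    forall a, before d a (n, l) -> exists2 b, before d b (n.+1, k) &
      monomial phi d b = g * monomial phi d a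
  & exists2 f, restrict f = g * y (n, l) &
    orthogonalisation I w (previous_OPs d Y n.+1 k) f (Y n.+1 k)].
Proof.
have restrict_x : restrict (curve_x phi) = 'X.
  by rewrite restrict_class hornerC.
have restrict_y : restrict (curve_y phi) = phi.
  by rewrite restrict_class hornerX.
move=> v; have [_ hx hlast hy] := hY.
have [nd|dn] := leqP n.+2 d; last first.
  exists k, phi; have vn : OP_index d n k by move: v; rewrite /OP_index; lia.
  split.
  - by move: v; rewrite /before /OP_before /OP_index /=; lia.
  - by apply: monomial_y_step => //=; case: leqP => //; lia.
  - by move=> a; apply: y_shift => //; case: leqP => //; lia.
  - exists (curve_y phi * Y n k); first by rewrite restrictM restrict_y.
    by apply: hy => //; move: v; rewrite /OP_index; lia.
have [kn|kn] := leqP k n.+1.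
  have k1 : (1 <= k <= n.+1)%N by move: v; rewrite /OP_index; lia.
  exists k, 'X; have vn : OP_index d n k by move: v; rewrite /OP_index; lia.
  split.
  - by move: v; rewrite /before /OP_before /OP_index /=; lia.
  - exact: (@monomial_x_step _ phi d (n, k)).
  - by move=> a; apply: x_shift.
  - exists (curve_x phi * Y n k); first by rewrite restrictM restrict_x.
    exact: hx.
have {v kn} -> : k = n.+2 by move: v; rewrite /OP_index; lia.
exists n.+1, phi; have vn : OP_index d n n.+1 by rewrite /OP_index; lia.
split.
- by rewrite /before /OP_before /OP_index /=; lia.
- by apply: monomial_y_step => //=; case: leqP => //; lia.
- by move=> a; apply: y_shift => //; case: leqP => //; lia.
- exists (curve_y phi * Y n n.+1); first by rewrite restrictM restrict_y.
  exact: hlast.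
Qed.

Lemma OP_steps a : OP_index d a.1 a.2 ->
  base_step (monomial phi d) y a \/
  inductive_step (before d) (monomial phi d) y a.
Proof.
case: a => [[|n] k] v.
  left; have {v} -> : k = 1%N by move: v; rewrite /OP_index /=; lia.
  rewrite /base_step.
  have -> : monomial phi d (0, 1)%N = 1.
    by rewrite /monomial /xexp /yexp /= min0n !expr0 mulr1.
  have [Y01 _ _ _] := hY; have [sp _ _] := hp.
  have [c c0 yE] : exists2 c, c != 0 & y (0, 1)%N = c%:P.
    have /eqP/size_poly1P[c c0 p0] := sp 0%N.
    by exists c; rewrite // /y /= Y01 restrict_class hornerC.
  rewrite yE; split.
    have [_ _ SZ] := lspan_subspace [set c%:P].
    have -> : 1 = c^-1 *: c%:P by rewrite -mul_polyC -polyCM mulVf.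
    by apply: SZ; apply: sub_lspan.
  have [_ _ SZ] := lspan_subspace [set (1 : {poly R})].
  by rewrite -[c%:P]mulr1 mul_polyC; apply: SZ; apply: sub_lspan.
right; have [l [g [bl gM shift [f fE orth]]]] := construction_step v.
exists (n, l), g.
have [h1 h2 _] := orthogonalisationE mI moments hp orth.
by rewrite fE restrict_previous in h1 h2; split.
Qed.

Lemma OP_in_monomial_span a : OP_index d a.1 a.2 ->
  lspan (up_to (before d) (monomial phi d) a) (y a).
Proof.
move=> v.
by have [] := triangular_up_to (D := [set a | OP_index d a.1 a.2])
  (@before_rankP d) (@before_dom d) (@before_trans d) OP_steps v.
Qed.

Lemma OP_orthogonal n k f : OP_index d n.+1 k ->
  lspan (earlier (before d) (monomial phi d) (n.+1, k)) f ->
  pdot I w (y (n.+1, k)) f = 0.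
Proof.
move=> v Mf.
have [l [g [_ _ _ [f0 _ orth]]]] := construction_step v.
have [_ _] := orthogonalisationE mI moments hp orth.
apply; rewrite restrict_previous.
exact: (triangular_earlier (D := [set a | OP_index d a.1 a.2])
  (@before_rankP d) (@before_dom d) (@before_trans d) OP_steps) Mf.
Qed.

Lemma conn_coef_pdot j n k : OP_index d n k ->
  conn_coef I w d p Y j (ell d n k) = pdot I w (y (n, k)) (p j).
Proof.
move=> v; rewrite conn_coefE //; last by lia.
by rewrite curve_dotE restrict_class hornerC.
Qed.

Lemma conn_coef_low j n k : OP_index d n.+1 k ->
  (forall e, (e <= j)%N -> (e %% d + e %/ d <= n)%N) ->
  conn_coef I w d p Y j (ell d n.+1 k) = 0.
Proof.
move=> v hj; rewrite conn_coef_pdot //; apply: OP_orthogonal => //.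
apply: (low_degree_span hd hphi (hj : forall e, (e < j.+1)%N -> _)).
by have [-> _ _] := hp.
Qed.

Lemma conn_coef_high j n k t : OP_index d n.+1 k ->
  (yexp d (n.+1, k) <= t)%N -> (maxn (n * d) (n.+1 + d.-1 * t) < j)%N ->
  conn_coef I w d p Y j (ell d n.+1 k) = 0.
Proof.
move=> v yt hj; rewrite conn_coef_pdot // pdotC.
apply: (orthonormal_low mI moments hp).
apply: leq_trans hj; apply: (size_up_to hd hphi yt v).
by apply: (@OP_in_monomial_span (_, _)).
Qed.

End Construction.

Theorem proposition5p6 (R : realType) (I : set R) (w : R -> R) (d : nat)
    (phi : {poly R}) (p : nat -> {poly R}) (Y : nat -> nat -> curve_ring phi)
    (hI : weight_interval I) (hw : is_weight I w)
    (hd : (3 <= d)%N) (hphi : size phi = d.+1)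
    (hp : orthonormal_polys I w p) (hY : curve_OPs I w d p Y) :
  (forall n : nat, (n <= d - 2)%N ->
     [/\ forall j k : nat, (j < n.+1)%N -> (1 <= k <= n.+2)%N ->
           conn_coef I w d p Y j (ell d n.+1 k) = 0,
         forall j k : nat, (n * d < j)%N -> (1 <= k <= n)%N ->
           conn_coef I w d p Y j (ell d n.+1 k) = 0,
         forall j : nat, (n * d + 1 < j)%N ->
           conn_coef I w d p Y j (ell d n.+1 n.+1) = 0
       & forall j : nat, (n.+1 * d < j)%N ->
           conn_coef I w d p Y j (ell d n.+1 n.+2) = 0])
  /\
  (forall n : nat, (d - 1 <= n)%N ->
     [/\ forall j k : nat, (j < d - 1 + d * (n + 2 - d))%N -> (1 <= k <= d)%N ->
           conn_coef I w d p Y j (ell d n.+1 k) = 0,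
         forall j k : nat, (n * d < j)%N -> (1 <= k <= d - 2)%N ->
           conn_coef I w d p Y j (ell d n.+1 k) = 0,
         forall j : nat, (n * d + 1 < j)%N ->
           conn_coef I w d p Y j (ell d n.+1 (d - 1)) = 0
       & forall j : nat, (n.+1 * d < j)%N ->
           conn_coef I w d p Y j (ell d n.+1 d) = 0]).
Proof.
have low := conn_coef_low hI hw hd hphi hp hY.
(* In each case of large [j], the exponent of phi in M(n+1, k) is bounded by
   n-1, n or n+1, so that the degree is at most n d, n d + 1 or (n+1) d. *)
have high := conn_coef_high hI hw hd hphi hp hY.
split=> n hn; split=> [j k hj hk|j k hj hk|j hj|j hj].
- apply: low => [|e ej]; first by rewrite /OP_index; lia.
  rewrite modn_small ?divn_small; lia.
- apply: (high _ _ _ n.-1); rewrite /OP_index /yexp /=; [lia|lia|nia].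
- apply: (high _ _ _ n); rewrite /OP_index /yexp /=; [lia|lia|nia].
- apply: (high _ _ _ n.+1); rewrite /OP_index /yexp /=; [lia|lia|nia].
- apply: low => [|e ej]; first by rewrite /OP_index; lia.
  (* The first monomial of row n + 1 has degree d - 1 + d (n + 2 - d); all
     smaller degrees belong to rows up to n. *)
  have := divn_eq e d; have := ltn_pmod e (ltnW (ltnW hd)).
  move: (e %% d)%N (e %/ d)%N => r q; nia.
- apply: (high _ _ _ n.-1); rewrite /OP_index /yexp /=; [lia|lia|nia].
- apply: (high _ _ _ n); rewrite /OP_index /yexp /=; [lia|lia|nia].
- apply: (high _ _ _ n.+1); rewrite /OP_index /yexp /=; [lia|lia|nia].
Qed.
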